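(* Let $\sigma$ and $\tau$ be permutations such that $\sigma$ occurs precisely once as a consecutive pattern in $\tau$, and suppose $\tau$ has a left tail of length $a$ and a right tail of length $b$ with respect to $\sigma$. Then $\mu(\sigma,\tau)=1$ if $a=b=0$ or $a=b=1$; $\mu(\sigma,\tau)=-1$ if $(a,b)=(0,1)$ or $(a,b)=(1,0)$; and $\mu(\sigma,\tau)=0$ otherwise.
   Context: Permutations are of $[d]=\{1,\dots,d\}$ for some $d\ge 1$. An occurrence of a consecutive pattern $\sigma=a_1\cdots a_k$ in $\tau=b_1\cdots b_n$ is a factor $b_ib_{i+1}\cdots b_{i+k-1}$ of consecutive letters of $\tau$ whose letters appear in the same relative order of size as the letters of $\sigma$. The set of all permutations is partially ordered by $\sigma\le\tau$ iff $\sigma$ occurs as a consecutive pattern in $\tau$; $\mu$ is the Möbius function of this poset: $\mu(x,x)=1$, $\mu(x,y)=-\sum_{x\le z<y}\mu(x,z)$ for $x<y$, and $\mu(x,y)=0$ if $x\not\le y$. If $\sigma$ occurs in $\tau=a_1\cdots a_n$, then $\tau$ has a left tail of length $i$ with respect to $\sigma$ if $a_{i+1}$ is the leftmost letter of $\tau$ involved in any occurrence of $\sigma$, and a right tail of length $j$ if $a_{n-j}$ is the rightmost letter of $\tau$ involved in any occurrence of $\sigma$. *)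

(* Defs.v *)
From HB Require Import structures.
From mathcomp Require Import all_boot all_order all_algebra all_fingroup.
From mathcomp Require Import zify.

Set Implicit Arguments.
Unset Strict Implicit.
Unset Printing Implicit Defensive.

Import Order.TTheory GRing.Theory Num.Theory.

(* The elements of length d.+1 are the permutations of 'I_d.+1 = {0, .., d};
   [word] shifts the values, so that it is the usual one-line notation with
   letters 1, .., d.+1. *)
Definition permutation : Type := {d : nat & 'S_d.+1}.

HB.instance Definition _ := Countable.on permutation.

Definition len (p : permutation) : nat := (tag p).+1.

Definition word (p : permutation) : seq nat :=
  [seq (tagged p x).+1 | x <- enum 'I_(len p)].

Definition same_relative_order (u v : seq nat) : bool :=
  (size u == size v) &&
  [forall x : 'I_(size u), forall y : 'I_(size u),
     (nth 0 u x < nth 0 u y) == (nth 0 v x < nth 0 v y)].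

(* Positions are counted from 0.  If the factor would run past the end of t,
   then [take] returns fewer than [len s] letters and the test fails. *)
Definition occurs_at (s t : permutation) (i : nat) : bool :=
  same_relative_order (take (len s) (drop i (word t))) (word s).

(* Bounding i by [len t] loses nothing, as permutations are nonempty. *)
Definition pattern_le (s t : permutation) : bool :=
  [exists i : 'I_(len t), occurs_at s t i].

Definition involved (s t : permutation) (j : nat) : Prop :=
  exists2 i, occurs_at s t i & i <= j < i + len s.

Definition left_tail (s t : permutation) (a : nat) : Prop :=
  involved s t a /\ forall j, involved s t j -> a <= j.

(* The letter a_(n - b), counted from 1, has position r = n - b - 1. *)
Definition right_tail (s t : permutation) (b : nat) : Prop :=
  exists r, [/\ (r + b).+1 = len t, involved s t r
              & forall j, involved s t j -> j <= r].

Lemma size_word p : size (word p) = len p.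
Proof. by rewrite size_map size_enum_ord. Qed.

Lemma nth_word p (x : 'I_(len p)) : nth 0 (word p) x = (tagged p x).+1.
Proof. by rewrite (nth_map x) ?size_enum_ord // nth_ord_enum. Qed.

Lemma occurs_atP s t i :
  reflect (i + len s <= len t /\
           forall x y, x < len s -> y < len s ->
             (nth 0 (word t) (i + x) < nth 0 (word t) (i + y)) =
             (nth 0 (word s) x < nth 0 (word s) y))
          (occurs_at s t i).
Proof.
have s_gt0 : 0 < len s by [].
apply: (iffP andP) => [[/eqP sz /forallP h]|[le_it h]].
  have le_it : i + len s <= len t.
    by move: sz; rewrite size_take size_drop !size_word; case: ifP; lia.
  split=> // x y ltx lty.
  rewrite sz size_word in h.
  have /forallP/(_ (Ordinal lty))/eqP := h (Ordinal ltx).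
  by rewrite /= !nth_take // !nth_drop.
have sz : size (take (len s) (drop i (word t))) = len s.
  by rewrite size_takel // size_drop size_word; lia.
split; first by rewrite sz size_word.
rewrite sz; apply/forallP=> x; apply/forallP=> y.
by rewrite !nth_take ?ltn_ord // !nth_drop h.
Qed.

Lemma pattern_leP s t : reflect (exists i, occurs_at s t i) (pattern_le s t).
Proof.
apply: (iffP existsP) => [[i si]|[i si]]; first by exists i.
have s_gt0 : 0 < len s by [].
have lti : i < len t by case/occurs_atP: si; lia.
by exists (Ordinal lti).
Qed.

Lemma pattern_le_refl : reflexive pattern_le.
Proof. by move=> s; apply/pattern_leP; exists 0; apply/occurs_atP. Qed.

Lemma pattern_le_trans : transitive pattern_le.
Proof.
move=> t s u /pattern_leP[i /occurs_atP[leis hs]].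
move=> /pattern_leP[j /occurs_atP[lejt ht]].
apply/pattern_leP; exists (j + i); apply/occurs_atP; split; first by lia.
by move=> x y ltx lty; rewrite -!addnA ht ?hs //; lia.
Qed.

Lemma pattern_le_len s t : pattern_le s t -> len s <= len t.
Proof. by case/pattern_leP=> i /occurs_atP[]; lia. Qed.

Lemma pattern_le_eq_len s t : pattern_le s t -> len s = len t -> s = t.
Proof.
case/pattern_leP=> i /occurs_atP[leit h] eqlen.
have i0 : i = 0 by lia.
move: eqlen; rewrite {i leit}i0 in h.
case: s h => d p; case: t => e q h [] /= eqde.
subst e; congr (existT _ d _).
have lt_pq x y : (q x < q y) = (p x < p y).
  have := h x y (ltn_ord x) (ltn_ord y); rewrite !add0n.
  rewrite (@nth_word (existT _ d q) x) (@nth_word (existT _ d q) y).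
  by rewrite (@nth_word (existT _ d p) x) (@nth_word (existT _ d p) y) /= !ltnS.
have rank (r : 'S_d.+1) x : #|[set y | r y < r x]| = r x.
  rewrite -[LHS](card_imset _ (@perm_inj _ r)).
  have -> : [set r y | y in [set y | r y < r x]] = [set z : 'I_d.+1 | z < r x].
    apply/setP=> z; rewrite inE; apply/imsetP/idP => [[y]|ltz].
      by rewrite inE => lty ->.
    by exists (r^-1 z)%g; rewrite ?inE permKV.
  rewrite cardsE cardE size_filter -enumT -(count_map val (fun z => z < r x)).
  rewrite val_enum_ord; have := ltn_ord (r x); move: (val (r x)) => m ltm.
  rewrite -(subnKC (ltnW ltm)) iotaD count_cat addnC.
  rewrite (eq_in_count (a2 := pred0)) ?count_pred0 => [|z]; last first.
    by rewrite mem_iota inE; lia.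
  rewrite (eq_in_count (a2 := predT)) ?count_predT ?size_iota => [|z] //.
  by rewrite mem_iota inE; lia.
apply/permP=> x; apply/val_inj; rewrite /= -(rank p) -(rank q).
by apply: eq_card => y; rewrite !inE lt_pq.
Qed.

Lemma pattern_le_anti : antisymmetric pattern_le.
Proof.
move=> s t /andP[st ts]; apply: pattern_le_eq_len => //.
by apply/eqP; rewrite eqn_leq !pattern_le_len.
Qed.

Fact pattern_display : Order.disp_t. Proof. exact: Order.Disp tt tt. Qed.

HB.instance Definition _ := Order.Le_isPOrder.Build pattern_display permutation
  pattern_le_refl pattern_le_anti pattern_le_trans.

Lemma le_pattern (s t : permutation) : (s <= t)%O = pattern_le s t.
Proof. by []. Qed.

Local Open Scope ring_scope.

(* The inner sums run over the permutations z of lengths 1, .., len t, hence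
   over all z with s <= z < t.  The fuel f only serves termination, see
   [mobius_eq], [mobius_lt] and [mobius_nle]. *)
Fixpoint mobius_rec (f : nat) (s t : permutation) : int :=
  if s == t then 1
  else if ~~ (s <= t)%O then 0
  else if f is f'.+1 then
    - \sum_(m < len t)
        \sum_(z : 'S_m.+1 | (s <= existT _ (m : nat) z :> permutation)%O
                            && (existT _ (m : nat) z < t :> permutation)%O)
          mobius_rec f' s (existT _ (m : nat) z)
  else 0.

Definition mobius (s t : permutation) : int := mobius_rec (len t) s t.

Lemma lt_len (s t : permutation) : (s < t)%O -> (len s < len t)%N.
Proof.
rewrite lt_neqAle => /andP[neq le_st]; rewrite ltn_neqAle pattern_le_len // andbT.
by apply: contraNneq neq => /(pattern_le_eq_len le_st) ->.
Qed.

Lemma mobius_recE f s t : (len t <= f)%N -> mobius_rec f s t = mobius s t.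
Proof.
rewrite /mobius; elim/ltn_ind: {t}(len t) {-2}t (erefl (len t)) f => n IH t en f.
case: n en IH => // n en IH; case: f => // f lef /=.
case: eqP => // _; case: ifP => // _; congr (- _).
apply: eq_bigr => m _; apply: eq_bigr => z /andP[_ /lt_len ltz].
have {}ltz : (len (existT _ (m : nat) z) < n.+1)%N by rewrite -en.
have [et] : (tag t).+1 = n.+1 by [].
have recE k : (n <= k)%N -> mobius_rec k s (existT _ (m : nat) z) =
    mobius_rec (len (existT _ (m : nat) z)) s (existT _ (m : nat) z).
  by move=> lek; apply: (IH _ ltz _ erefl); apply: leq_trans lek.
by rewrite recE ?[RHS]recE ?et // -ltnS -en.
Qed.

Lemma mobius_eq s : mobius s s = 1.
Proof. by rewrite /mobius /= eqxx. Qed.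

Lemma mobius_nle (s t : permutation) : ~~ (s <= t)%O -> mobius s t = 0.
Proof.
move=> nle; rewrite /mobius /= nle; case: eqP => // eqst.
by rewrite eqst lexx in nle.
Qed.

Lemma mobius_lt (s t : permutation) : (s < t)%O ->
  mobius s t =
  - \sum_(m < len t)
      \sum_(z : 'S_m.+1 | (s <= existT _ (m : nat) z :> permutation)%O
                          && (existT _ (m : nat) z < t :> permutation)%O)
        mobius s (existT _ (m : nat) z).
Proof.
move=> ltst; rewrite {1}/mobius /= (lt_eqF ltst) (ltW ltst) /=; congr (- _).
apply: eq_bigr => m _; apply: eq_bigr => z /andP[_ /lt_len ltz].
by rewrite mobius_recE.
Qed.

(* Main.v *)
Require Import Defs.
From mathcomp Require Import all_boot all_order all_algebra all_fingroup.
From mathcomp Require Import zify.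

Set Implicit Arguments.
Unset Strict Implicit.
Unset Printing Implicit Defensive.

Import Order.TTheory GRing.Theory Num.Theory.

(** If sigma occurs only once in tau, then every z in [sigma, tau] contains
    sigma exactly once, and z is the pattern of the factor of tau obtained by
    extending the occurrence of sigma by k <= a letters to the left and by
    l <= b letters to the right, where (k, l) is determined by z.  Hence
    [sigma, tau] is a product of chains with a + 1 and b + 1 elements, whose
    Moebius function is the product of those of the chains. *)

Lemma occurs_at_trans s z t i k :
  occurs_at s z k -> occurs_at z t i -> occurs_at s t (i + k).
Proof.
move=> /occurs_atP[les hs] /occurs_atP[lez hz]; apply/occurs_atP; split; first lia.
by move=> x y ltx lty; rewrite -!addnA hz ?hs //; lia.
Qed.

(** Partial converse of [occurs_at_trans]: the bound on [k] says that the occurrence of [s] lies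
    within that of [z], so its letters can be compared in [z]. *)
Lemma occurs_at_factor s z t i k :
  occurs_at z t i -> occurs_at s t (i + k) -> k + len s <= len z ->
  occurs_at s z k.
Proof.
move=> /occurs_atP[lez hz] /occurs_atP[les hs] le; apply/occurs_atP; split=> //.
by move=> x y ltx lty; rewrite -hz; [rewrite !addnA hs | lia..].
Qed.

Lemma occurs_at_inj p q t i :
  occurs_at p t i -> occurs_at q t i -> len p = len q -> p = q.
Proof.
move=> hp hq eqlen; apply: pattern_le_eq_len => //; apply/pattern_leP.
by exists 0; apply: (occurs_at_factor hq); rewrite ?addn0 // eqlen.
Qed.

Lemma word_inj p i j : i < len p -> j < len p ->
  nth 0 (word p) i = nth 0 (word p) j -> i = j.
Proof.
move=> lti ltj; rewrite (nth_word (Ordinal lti)) (nth_word (Ordinal ltj)).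
by move=> [/val_inj/perm_inj[]].
Qed.

(** The rank of a position, the number of positions with a smaller value, serves as [z]; ranks are
    distinct because [w] is injective on the window. *)
Lemma standardization n (w : nat -> nat) :
  {in gtn n.+1 &, injective w} ->
  exists z : 'S_n.+1, forall x y : 'I_n.+1, (z x < z y) = (w x < w y).
Proof.
move=> w_inj; pose r (x : 'I_n.+1) := #|[set y : 'I_n.+1 | w y < w x]|.
have r_lt x : r x < n.+1.
  rewrite -[n.+1]card_ord -cardsT; apply: proper_card; apply/properP; split.
    exact: subsetT.
  (* No position lies below itself, so its rank is less than [n.+1]. *)
  by exists x; rewrite !inE // ltnn.
have r_mono x y : (r x < r y) = (w x < w y).
  have le (u v : 'I_n.+1) : w u <= w v -> r u <= r v.
    move=> uv; apply: subset_leq_card; apply/subsetP=> k.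
    by rewrite !inE => /leq_trans; apply.
  case: (ltnP (w x) (w y)) => [xy|/le]; last by rewrite leqNgt => /negbTE.
  apply: proper_card; apply/properP; split.
    by apply/subsetP=> k; rewrite !inE => /ltn_trans; apply.
  by exists x; rewrite !inE // ltnn.
have f_inj : injective (fun x => Ordinal (r_lt x)).
  move=> x y [exy]; apply/val_inj/w_inj; rewrite ?inE ?ltn_ord //.
  have := r_mono x y; have := r_mono y x; rewrite exy !ltnn.
  by case: ltngtP.
by exists (perm f_inj) => x y; rewrite !permE /= r_mono.
Qed.

(* The identity if the factor of length n.+1 would run past the end of t. *)
Definition factor (t : permutation) (i n : nat) : permutation :=
  existT _ n (odflt 1%g [pick z : 'S_n.+1 | occurs_at (existT _ n z) t i]).

Lemma factor_occurs t i n : i + n.+1 <= len t -> occurs_at (factor t i n) t i.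
Proof.
move=> le; rewrite /factor; case: pickP => [z //|no].
have [] := @standardization n (fun x => nth 0 (word t) (i + x)).
  by move=> x y; rewrite !inE => ltx lty /word_inj h; apply: (@addnI i); apply: h; lia.
move=> z hz; have /negP[] := negbT (no z); apply/occurs_atP; split=> // x y ltx lty.
rewrite (@nth_word (existT _ n z) (Ordinal ltx)).
by rewrite (@nth_word (existT _ n z) (Ordinal lty)) /= ltnS hz.
Qed.

(** A flat list in place of the double sum of [mobius_lt], so that an interval can be reindexed by
    [perm_big]. *)
Definition perms_upto (n : nat) : seq permutation :=
  [seq existT _ m z | m <- iota 0 n, z <- enum {: 'S_m.+1}].

Lemma mem_perms_upto n p : (p \in perms_upto n) = (len p <= n).
Proof.
apply/allpairsPdep/idP => [[m [z [+ _ ->]]]|le]; first by rewrite mem_iota.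
by case: p le => m z le; exists m, z; rewrite mem_iota mem_enum.
Qed.

Lemma perms_upto_uniq n : uniq (perms_upto n).
Proof.
apply: allpairs_uniq_dep => [|m _|[m z] [m' z'] _ _ //]; first exact: iota_uniq.
exact: enum_uniq.
Qed.

Local Open Scope ring_scope.

Lemma big_perms_upto n (P : pred permutation) (G : permutation -> int) :
  \sum_(z <- perms_upto n | P z) G z =
  \sum_(m < n) \sum_(z : 'S_m.+1 | P (existT _ (m : nat) z))
    G (existT _ (m : nat) z).
Proof.
rewrite big_mkcond /perms_upto big_allpairs_dep /=.
rewrite -[n in iota 0 n]subn0 -/(index_iota 0 n) big_mkord.
by apply: eq_bigr => m _; rewrite big_enum [RHS]big_mkcond.
Qed.

(** This is [mobius_lt] with the term [z = t] moved into the sum. *)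
Lemma sum_mobius (s t : permutation) : (s < t)%O ->
  \sum_(z <- perms_upto (len t) | (s <= z)%O && (z <= t)%O) mobius s z = 0.
Proof.
move=> lt_st; rewrite big_mkcond /= (bigD1_seq t) ?mem_perms_upto ?perms_upto_uniq //=.
rewrite ltW // lexx /= (mobius_lt lt_st) -big_mkcondr addrC.
rewrite -(big_perms_upto _ (fun z => (s <= z)%O && (z < t)%O)).
apply/eqP; rewrite subr_eq0; apply/eqP/eq_bigl => z.
by rewrite lt_neqAle andbCA.
Qed.

(** The Moebius function of a chain from its bottom to the element of rank [n]: 1, -1, 0, 0, and so
    on. *)
Definition chain_mobius (n : nat) : int := (n == 0%N)%:R - (n == 1%N)%:R.

Lemma sum_chain_mobius n : \sum_(0 <= k < n.+1) chain_mobius k = (n == 0%N)%:R.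
Proof.
elim: n => [|n IH]; first by rewrite big_nat1.
by rewrite big_nat_recr //= IH /chain_mobius; case: n {IH}.
Qed.

Section SingleOccurrence.

Variables (s t : permutation) (a b : nat).
Hypotheses (occ : occurs_at s t a) (occ_uniq : forall i, occurs_at s t i -> i = a).
Hypothesis lenE : (a + len s + b)%N = len t.

(** [factor] expects the length minus one, hence [tag s] and not [len s]. *)
Definition extension k l : permutation := factor t (a - k) (k + tag s + l).

Lemma len_extension k l : len (extension k l) = (k + len s + l)%N.
Proof. by rewrite /len /= addnS addSn. Qed.

Lemma extension_occurs k l : (k <= a)%N -> (l <= b)%N -> occurs_at (extension k l) t (a - k).
Proof. by move=> ka lb; apply: factor_occurs; rewrite -lenE /len; lia. Qed.

Lemma occurs_extension k l : (k <= a)%N -> (l <= b)%N -> occurs_at s (extension k l) k.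
Proof.
move=> ka lb; apply: (occurs_at_factor (extension_occurs ka lb)); first by rewrite subnK.
by rewrite len_extension; lia.
Qed.

Lemma occurs_extension_uniq k l j : (k <= a)%N -> (l <= b)%N -> occurs_at s (extension k l) j -> j = k.
Proof. by move=> ka lb /occurs_at_trans/(_ (extension_occurs ka lb))/occ_uniq; lia. Qed.

Lemma extension_top : extension a b = t.
Proof.
apply: (@occurs_at_inj _ _ t 0); last by rewrite len_extension.
  by rewrite -(subnn a); apply: extension_occurs.
by apply/occurs_atP.
Qed.

(** The map from pairs [(k, l)] is injective: [k] is the only position of [s] in the extension, and
    then the length determines [l]. It is surjective: if [z] occurs at [i] in [t] and [s] at [k] in
    [z], then [i + k = a]. *)
Lemma interval_perm_eq :
  perm_eq [seq z <- perms_upto (len t) | (s <= z)%O && (z <= t)%O]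
          [seq extension k l | k <- iota 0 a.+1, l <- iota 0 b.+1].
Proof.
apply: uniq_perm; first by rewrite filter_uniq // perms_upto_uniq.
  apply: allpairs_uniq; rewrite ?iota_uniq // => -[k l] [k' l'].
  move=> /allpairsP[[k1 l1] [ka lb [-> ->]]].
  move=> /allpairsP[[k2 l2] [ka' lb' [-> ->]]].
  move: ka lb ka' lb'; rewrite !mem_iota !add0n !ltnS /= => ka lb ka' lb' eqF.
  have ek : k1 = k2.
    by apply: (occurs_extension_uniq ka' lb'); rewrite -eqF occurs_extension.
  by have := congr1 len eqF; rewrite !len_extension ek => el; congr pair; lia.
move=> z; rewrite mem_filter mem_perms_upto.
apply/idP/allpairsP => [/andP[/andP[sz zt] _]|[[k l] [ka lb ->]]]; last first.
  rewrite !mem_iota !add0n !ltnS /= in ka lb.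
  rewrite len_extension !le_pattern -!andbA; apply/and3P; split; last by rewrite /=; lia.
  - by apply/pattern_leP; exists k; apply: occurs_extension.
  - by apply/pattern_leP; exists (a - k)%N; apply: extension_occurs.
have /pattern_leP[k sk] := sz; have /pattern_leP[i zi] := zt.
have ik : (i + k)%N = a by apply/occ_uniq/(occurs_at_trans sk zi).
have /occurs_atP[lek _] := sk; have /occurs_atP[lei _] := zi.
exists (k, len z - (k + len s))%N; rewrite !mem_iota /=; split; [lia..|].
apply: (occurs_at_inj zi); last by rewrite len_extension; lia.
by rewrite (_ : i = a - k)%N; [apply: extension_occurs; lia | lia].
Qed.

End SingleOccurrence.

(** Induction on [len t]: if [s < t], both sides sum to 0 over the interval and agree below its top,
    hence also at the top. *)
Lemma mobius_single_occurrence s t a b :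
  occurs_at s t a -> (forall i, occurs_at s t i -> i = a) ->
  (a + len s + b)%N = len t ->
  mobius s t = chain_mobius a * chain_mobius b.
Proof.
elim/ltn_ind: {t}(len t) {-2}t (erefl (len t)) a b => n IH t en a b occ uniq lenE.
have [ab0|ab_neq0] := eqVneq (a + b)%N 0%N.
  have -> : s = t by apply: pattern_le_eq_len; [apply/pattern_leP; exists a | lia].
  have [-> ->] : a = 0%N /\ b = 0%N by lia.
  by rewrite mobius_eq /chain_mobius subr0 mulr1.
have lt_st : (s < t)%O.
  rewrite lt_neqAle le_pattern; apply/andP; split; last by apply/pattern_leP; exists a.
  by apply/eqP => /(congr1 len); lia.
have sum0 : \sum_(0 <= k < a.+1) \sum_(0 <= l < b.+1)
    mobius s (extension s t a k l) = 0.
  rewrite -[RHS](sum_mobius lt_st) -[RHS]big_filter.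
  by rewrite (perm_big _ (interval_perm_eq occ uniq lenE)) big_allpairs_dep.
have IHe k l : (k <= a)%N -> (l <= b)%N -> (k + l < a + b)%N ->
    mobius s (extension s t a k l) = chain_mobius k * chain_mobius l.
  move=> ka lb lt; apply: (IH _ _ _ erefl); rewrite ?len_extension //; first lia.
    exact: (occurs_extension occ lenE ka lb).
  by move=> i; apply: (occurs_extension_uniq occ uniq lenE ka lb).
have : \sum_(0 <= k < a.+1) \sum_(0 <= l < b.+1)
    (mobius s (extension s t a k l) - chain_mobius k * chain_mobius l) = 0.
  under eq_bigr do rewrite sumrB -mulr_sumr sum_chain_mobius.
  rewrite sumrB -mulr_suml sum_chain_mobius sum0 sub0r.
  (* What remains is the product of the indicators of [a = 0] and [b = 0], which vanishes as [a + b]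
     is nonzero. *)
  by case: (a) (b) ab_neq0 => [|?] [|?]; rewrite ?mul0r ?mulr0 ?oppr0.
(* By [IHe] the rows [k < a] vanish, then the entries [l < b] of row [a]; only the term at [(a, b)]
   is left. *)
rewrite big_nat_recr //= big_nat big1 => [|k /andP[_ ka]]; last first.
  by rewrite big_nat big1 // => l /andP[_ lb]; rewrite IHe ?subrr //; lia.
rewrite add0r big_nat_recr //= big_nat big1 => [|l /andP[_ lb]]; last first.
  by rewrite IHe ?subrr //; lia.
by rewrite add0r (extension_top occ lenE) => /eqP; rewrite subr_eq0 => /eqP.
Qed.

Theorem theorem2p1 (sigma tau : permutation) (a b : nat) :
  (exists! i : nat, occurs_at sigma tau i) ->
  left_tail sigma tau a ->
  right_tail sigma tau b ->
  mobius sigma tau =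
    (if (a, b) \in [:: (0, 0); (1, 1)]%N then 1
     else if (a, b) \in [:: (0, 1); (1, 0)]%N then -1
     else 0).
Proof.
move=> [i [occ uniq_i]] [[i1 occ1 le_a] min_a] [r [lenE [i2 occ2 le_r] max_r]].
have s_gt0 : (0 < len sigma)%N by [].
have ei1 := uniq_i _ occ1; have ei2 := uniq_i _ occ2; subst i1 i2.
(* The involved positions are exactly those from [i] to [i + len sigma - 1]. *)
have ea : a = i.
  by apply/eqP; rewrite eqn_leq min_a; [lia | exists i => //; lia].
have er : r = (i + len sigma).-1.
  by apply/eqP; rewrite eqn_leq max_r ?andbT; [lia | exists i => //; lia].
subst a r; rewrite (mobius_single_occurrence (b := b) occ); first last.
- lia.
- by move=> j /uniq_i.
rewrite /chain_mobius !inE !xpair_eqE.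
by case: i {occ uniq_i occ1 occ2 le_a le_r min_a max_r lenE} => [|[|?]]; case: b => [|[|?]].
Qed.
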